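(* Let $c\in(0,1/5)$ and set $\delta=10^{-10}$. Then there is $\varepsilon_0=\varepsilon_0(c)>0$ such that for every $0<\varepsilon<\varepsilon_0$ there exists $n_0\in\mathbb{N}$ such that the following holds for all integers $n,s$ with $n\ge n_0$ and $cn\le s\le (n-3)/(5-\delta)$. If $G$ is a stable $4$-graph on $[n]$ with fractional matching number $\nu^*(G)\le s$ and $e(G)\ge\binom{n}{4}-\binom{n-s}{4}-\varepsilon n^4$, then $G$ is $100\varepsilon^{1/4}$-close to $H_1$.
   Context: A $4$-graph on $[n]$ is a family of $4$-element subsets (edges) of $[n]$; $e(G)$ is the number of edges. A fractional matching of a hypergraph $G=(V,E)$ is a function $\phi:E\to[0,1]$ with $\sum_{e\ni v}\phi(e)\le 1$ for every $v\in V$; its size is $\sum_{e\in E}\phi(e)$, and $\nu^*(G)$ is the maximum size of a fractional matching. A $k$-graph $G$ on $[n]$ is stable if for every edge $\{a_1,\dots,a_k\}$ and every $\{b_1,\dots,b_k\}\in\binom{[n]}{k}$ with $b_i\le a_i$ for all $i$, $\{b_1,\dots,b_k\}$ is also an edge. For $k$-graphs $G,H$ on the same $n$-element vertex set, $G$ is $\varepsilon$-close to $H$ if $|E(H)\setminus E(G)|<\varepsilon n^k$. $H_1$ is the $4$-graph on $[n]$ whose edges are all $e\in\binom{[n]}{4}$ with $e\cap[s]\ne\emptyset$. *)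

(* Defs.v *)
(* The vertex set [n] is 'I_n: vertices are numbered 0, ..., n-1 instead of
   1, ..., n. *)
From HB Require Import structures.
From mathcomp Require Import all_boot all_order all_algebra.
From mathcomp Require Import classical_sets reals.
(* Required last so that set notations denote finite sets. *)
From mathcomp Require Import finset.

Set Implicit Arguments.
Unset Strict Implicit.
Unset Printing Implicit Defensive.

Import Order.TTheory GRing.Theory Num.Theory.

Local Open Scope ring_scope.

Definition is_kgraph (k n : nat) (G : {set {set 'I_n}}) : Prop :=
  forall e : {set 'I_n}, e \in G -> #|e| = k.

(* The values of phi outside of G are irrelevant. *)
Definition fractional_matching (R : realType) (n : nat) (G : {set {set 'I_n}})
    (phi : {set 'I_n} -> R) : Prop :=
  (forall e : {set 'I_n}, e \in G -> 0 <= phi e <= 1) /\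
  (forall v : 'I_n, \sum_(e in G | v \in e) phi e <= 1).

Definition matching_size (R : realType) (n : nat) (G : {set {set 'I_n}})
    (phi : {set 'I_n} -> R) : R :=
  \sum_(e in G) phi e.

(* The set of sizes contains 0, is bounded by #|G| and is compact, so its
   supremum is a maximum. *)
Definition fractional_matching_number (R : realType) (n : nat)
    (G : {set {set 'I_n}}) : R :=
  sup [set x : R | exists2 phi : {set 'I_n} -> R,
    fractional_matching G phi & x = matching_size G phi]%classic.

(* The k-subsets are presented by arbitrary enumerations; the cardinality
   condition says that b_1, ..., b_k are distinct. *)
Definition is_stable (k n : nat) (G : {set {set 'I_n}}) : Prop :=
  forall a b : 'I_k -> 'I_n,
    [set a i | i : 'I_k] \in G ->
    #|[set b i | i : 'I_k]| = k ->
    (forall i : 'I_k, (b i <= a i)%N) ->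
    [set b i | i : 'I_k] \in G.

Definition eps_close (R : realType) (k n : nat) (eps : R)
    (G H : {set {set 'I_n}}) : Prop :=
  #|H :\: G|%:R < eps * n%:R ^+ k.

(* With vertices numbered from 0, [s] is the set of vertices i < s. *)
Definition H1 (n s : nat) : {set {set 'I_n}} :=
  [set e : {set 'I_n} |
    (#|e| == 4%N) && (e :&: [set i : 'I_n | (i < s)%N] != set0)].

(* Main.v *)
(* A fractional vertex cover [w] of [G] of weight at most [s] (LP duality) may be
   taken nonincreasing, because [G] is stable, and bounded by 1. Let [A] be the
   first [s] vertices, [B] the others, and [M] the largest weight on [B]. Then
   [x := w / M] takes values in [0, 1] on [B], [D := (1 - w) / M] takes values in
   [0, d] on [A] with [d + 1 = 1 / M], and the weight bound says that [D] has at
   least the total mass of [x]. An edge of [G] outside [H1] is a quadruple of [B]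
   with [x]-sum at least [d + 1]; a vertex [i] of [A] and a triple of [B] with
   [x]-sum less than [D i] form an edge of [H1] missing from [G]. So it suffices
   to compare, for independent copies of [x] and [D], the probabilities [P] that
   four [x]'s sum to at least [d + 1] and [F] that three [x]'s sum to less than
   [D]: when [E D >= 3.99 E x] one has [F >= 1.01 P]. Hence the loss of [G]
   compared with [H1] is at least 1.01 times its gain, up to O(n^3), and since the
   loss exceeds the gain by at most [eps n^4], it is itself O(eps n^4).

   The comparison rests on two pointwise estimates. For every [lam] in [0, 1],
     (d - lam) 1[S < D] >= D - S - lam (1-x1)(1-x2)(1-x3) + max(S - d, 0)
   with S = x1+x2+x3. Elementary symmetric polynomials bound the other side:
   e2 >= 2 e1 - 3, e3 - 2 e4 >= e1 - 2 and e4 >= e1 - 3 on the cube. After taking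
   expectations only an inequality between polynomials in [d] and [z = E x]
   remains. *)
Require Import Defs.
From HB Require Import structures.
From mathcomp Require Import all_boot all_order all_algebra.
From mathcomp Require Import reals exp.
From mathcomp Require Import boolp fingroup perm zify ring lra.

Set Implicit Arguments.
Unset Strict Implicit.
Unset Printing Implicit Defensive.

Import Order.TTheory GRing.Theory Num.Theory.

Local Open Scope ring_scope.

(** * The inequality between polynomials *)

(* With these products as hypotheses [lra] decides the univariate quartic
   inequalities below: their Bernstein coefficients on [l, h] are nonnegative. *)
Lemma bernstein4_ge0 (R : realFieldType) (l h x : R) : l <= x -> x <= h ->
  [/\ 0 <= (h - x) ^+ 4, 0 <= (x - l) * (h - x) ^+ 3,
      0 <= (x - l) ^+ 2 * (h - x) ^+ 2, 0 <= (x - l) ^+ 3 * (h - x) &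
      0 <= (x - l) ^+ 4].
Proof.
by move=> lx xh; split; rewrite ?mulr_ge0 ?exprn_ge0 // subr_ge0.
Qed.

(** Dividing the bound [csP3] by [z] leaves this polynomial; monotonicity reduces a range of [z] to
    its right endpoint. *)
Lemma quartic_mono (R : realFieldType) (x y : R) : 0 <= x -> x <= y -> y <= 1 ->
  4 * x ^+ 2 - 2 * x ^+ 3 <= 4 * y ^+ 2 - 2 * y ^+ 3.
Proof.
move=> x0 xy y1.
have h1 : 0 <= (y - x) * (y * (1 - y)) by rewrite !mulr_ge0 ?subr_ge0 //; lra.
have h2 : 0 <= (y - x) * (x * (1 - y)) by rewrite !mulr_ge0 ?subr_ge0 //; lra.
have h3 : 0 <= (y - x) * (x * (1 - x)) by rewrite !mulr_ge0 ?subr_ge0 //; lra.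
have h4 : 0 <= (y - x) * y by rewrite !mulr_ge0 ?subr_ge0 //; lra.
have h5 : 0 <= (y - x) * x by rewrite !mulr_ge0 ?subr_ge0 //; lra.
lra.
Qed.

Lemma cube_anti (R : realFieldType) (x y : R) : x <= y -> y <= 1 ->
  (1 - y) ^+ 3 <= (1 - x) ^+ 3.
Proof. by move=> xy y1; rewrite lerXn2r ?nnegrE ?subr_ge0 ?lerD2l ?lerN2 ?(le_trans xy). Qed.

(* [z] stands for the mean of a random variable with values in [0, 1], [P] for
   the probability that four independent copies sum to at least [d + 1], and [F]
   for the probability that three copies sum to less than an independent
   [D : [0, d]] of mean (almost) [4 * z]. *)
Record clamp_system (R : realFieldType) (d z P F : R) : Prop := ClampSystem {
  csz0 : 0 <= z;
  csz1 : z <= 1;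
  cszd : 399 / 100 * z <= d;
  csP0 : 0 <= P;
  csP1 : (d + 1) * P <= 4 * z;
  csP2 : (2 * d - 1) * P <= 6 * z ^+ 2;
  csP3 : (d - 1) * P <= 4 * z ^+ 3 - 2 * z ^+ 4;
  csP4 : (d - 2) * P <= z ^+ 4;
  csP5 : 3 < d -> P = 0;
  csF0 : 0 <= F;
  csF : forall lam, 0 <= lam -> lam <= 1 -> lam <= d ->
    99 / 100 * z - lam * (1 - z) ^+ 3 + (3 - d) / 4 * P <= (d - lam) * F }.

(** Multiply the goal by [d - lam] and subtract the term [(3 - d) / 4 * P] of [csF]: the coefficient
    [101 / 100 * (d - lam) - (3 - d) / 4] of [P] is the one displayed. *)
Lemma clamp_suff (R : realFieldType) (d z P F lam : R) :
  clamp_system d z P F -> 0 <= lam -> lam <= 1 -> lam < d ->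
  (63 / 50 * d - 3 / 4 - 101 / 100 * lam) * P <=
    99 / 100 * z - lam * (1 - z) ^+ 3 ->
  101 / 100 * P <= F.
Proof.
move=> S l0 l1 ld H; have dl : 0 < d - lam by rewrite subr_gt0.
rewrite -(ler_pM2l dl); have := csF S l0 l1 (ltW ld).
by move: H; clear; lra.
Qed.

(* [lam] is chosen so that the coefficient of [P] vanishes. *)
Lemma clamp_vanish (R : realFieldType) (d z P F b y : R) :
  clamp_system d z P F -> 3 / 4 < d -> d < 3 ->
  63 / 50 * d - 3 / 4 <= b -> b <= 1 ->
  0 <= y -> y <= z -> b * (1 - y) ^+ 3 <= 99 / 100 * y -> 101 / 100 * P <= F.
Proof.
move=> S d34 d3; have z1 := csz1 S.
have : 0 < 63 / 50 * d - 3 / 4 by lra.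
(* By [d < 3], the value of [lam] chosen below is less than [d]. *)
have : 63 / 50 * d - 3 / 4 - 101 / 100 * d < 0 by lra.
move: (63 / 50 * d - 3 / 4) (@clamp_suff R d z P F) => c suff.
move=> cd c0 cb b1 y0 yz H.
have b0 : 0 <= b by lra.
have u0 : 0 <= (1 - z) ^+ 3 by apply: exprn_ge0; rewrite subr_ge0.
have h1 : (1 - z) ^+ 3 <= (1 - y) ^+ 3 by apply: cube_anti.
have h2 : c * (1 - z) ^+ 3 <= b * (1 - z) ^+ 3 by apply: ler_wpM2r.
have h3 : b * (1 - z) ^+ 3 <= b * (1 - y) ^+ 3 by apply: ler_wpM2l.
have cu0 : 0 <= c * (1 - z) ^+ 3 by apply: mulr_ge0 => //; apply: ltW.
apply: (suff (c * (100 / 101))) => //.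
- by move: c0; clear; lra.
- by move: cb b1; clear; lra.
- by move: cd; clear; lra.
have -> : c - 101 / 100 * (c * (100 / 101)) = 0 by field.
rewrite mul0r [c * _ * _]mulrAC; move: y0 yz H h2 h3 cu0; clear.
by move: (c * _) (b * (1 - z) ^+ 3) (b * (1 - y) ^+ 3) => X Y Z; lra.
Qed.

(** The choice [lam := 0]. The tail bound carries a factor [z], which cancels against the one in
    [99 / 100 * z]. *)
Lemma clamp_zero (R : realFieldType) (d z P F t G : R) :
  clamp_system d z P F ->
  0 < t -> 0 <= 63 / 50 * d - 3 / 4 -> 0 < d -> t * P <= z * G ->
  (63 / 50 * d - 3 / 4) * G <= 99 / 100 * t -> 101 / 100 * P <= F.
Proof.
move=> S t0 c0 d0 HP HG; apply: (clamp_suff S (lexx 0)) => //.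
rewrite !mulr0 mul0r !subr0 -(ler_pM2l t0).
have := ler_wpM2l c0 HP; have := ler_wpM2l (csz0 S) HG; clear; lra.
Qed.

(** The choice [lam := 1], with [44 / 25 = 3 / 4 + 101 / 100]. *)
Lemma clamp_one (R : realFieldType) (d z P F t G : R) :
  clamp_system d z P F ->
  0 < t -> 1 < d -> t * P <= G ->
  0 <= 99 / 100 * z - (1 - z) ^+ 3 ->
  (63 / 50 * d - 44 / 25) * G <= t * (99 / 100 * z - (1 - z) ^+ 3) ->
  101 / 100 * P <= F.
Proof.
move=> S t0 d1 HP N0 HG; apply: (@clamp_suff R d z P F 1) => //.
rewrite mulr1 mul1r.
have -> : 63 / 50 * d - 3 / 4 - 101 / 100 = 63 / 50 * d - 44 / 25.
  by field.
have [c0|c0] := lerP (63 / 50 * d - 44 / 25) 0.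
  by apply: le_trans N0; rewrite mulr_le0_ge0 // (csP0 S).
rewrite -(ler_pM2l t0); apply: le_trans HG.
by rewrite mulrCA ler_pM2l.
Qed.

Lemma clamp_zero_mid (R : realFieldType) (d z P F y : R) :
  clamp_system d z P F -> 1 < d -> z <= y -> y <= 1 ->
  (63 / 50 * d - 3 / 4) * (4 * y ^+ 2 - 2 * y ^+ 3) <= 99 / 100 * (d - 1) ->
  101 / 100 * P <= F.
Proof.
move=> S d1 zy y1 H; have z0 := csz0 S.
apply: (clamp_zero S _ _ _ _ H); try by move: d1; clear; lra.
have : z * (4 * z ^+ 2 - 2 * z ^+ 3) <= z * (4 * y ^+ 2 - 2 * y ^+ 3).
  exact: ler_wpM2l (quartic_mono z0 zy y1).
by move: (csP3 S); clear; lra.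
Qed.

(** Add the two endpoint inequalities with weights [y - e] and [e - x]. *)
Lemma affine_le (R : realFieldType) (a b x y e f G N : R) :
  x < y -> x <= e -> e <= y ->
  (a * x - b) * G <= (x - f) * N -> (a * y - b) * G <= (y - f) * N ->
  (a * e - b) * G <= (e - f) * N.
Proof.
move=> xy xe ey H1 H2.
have yx : 0 < y - x by rewrite subr_gt0.
have h1 : 0 <= y - e by rewrite subr_ge0.
have h2 : 0 <= e - x by rewrite subr_ge0.
rewrite -(ler_pM2l yx).
by have := ler_wpM2l h1 H1; have := ler_wpM2l h2 H2; clear; lra.
Qed.

(* For fixed [z] the inequality wanted is affine in [d]. *)
Lemma clamp_one_mid (R : realFieldType) (d z P F d1 d2 : R) :
  clamp_system d z P F ->
  1 < d1 -> d1 < d2 -> d1 <= d -> d <= d2 -> 1 / 3 <= z ->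
  (63 / 50 * d1 - 44 / 25) * (4 * z ^+ 3 - 2 * z ^+ 4) <=
    (d1 - 1) * (99 / 100 * z - (1 - z) ^+ 3) ->
  (63 / 50 * d2 - 44 / 25) * (4 * z ^+ 3 - 2 * z ^+ 4) <=
    (d2 - 1) * (99 / 100 * z - (1 - z) ^+ 3) ->
  101 / 100 * P <= F.
Proof.
move=> S d1_gt1 d12 d1d dd2 zz H1 H2.
have d_gt1 : 1 < d by apply: lt_le_trans d1d.
apply: (clamp_one S _ d_gt1 (csP3 S)); first by rewrite subr_gt0.
  have h : (1 - z) ^+ 3 <= (1 - 1 / 3) ^+ 3 by apply: cube_anti (csz1 S).
  by move: h zz; clear; lra.
exact: affine_le H1 H2.
Qed.

(** Degree five appears when [d] is replaced by the endpoint [399 / 100 * z]. *)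
Lemma bernstein5_ge0 (R : realFieldType) (l h x : R) : l <= x -> x <= h ->
  [/\ 0 <= (h - x) ^+ 5, 0 <= (x - l) * (h - x) ^+ 4,
      0 <= (x - l) ^+ 2 * (h - x) ^+ 3 &
   [/\ 0 <= (x - l) ^+ 3 * (h - x) ^+ 2, 0 <= (x - l) ^+ 4 * (h - x) &
      0 <= (x - l) ^+ 5]].
Proof.
by move=> lx xh; split; [..|split]; rewrite ?mulr_ge0 ?exprn_ge0 // subr_ge0.
Qed.

Lemma clamp_one_high (R : realFieldType) (d z P F : R) :
  clamp_system d z P F -> 9 / 4 < d -> d <= 3 -> 12 / 25 <= z ->
  101 / 100 * P <= F.
Proof.
move=> S d0 d3 z48; have zd := cszd S.
have [d1 d2] : 1 < d /\ 0 < d - 2 by split; lra.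
apply: (clamp_one S d2 d1 (csP4 S)).
  have h : (1 - z) ^+ 3 <= (1 - 12 / 25) ^+ 3 by apply: cube_anti (csz1 S).
  by move: h z48; clear; lra.
(* Beyond [141 / 250], [399 / 100 * z] exceeds [9 / 4] and becomes the left endpoint for [d]. *)
have [z56|z56] := lerP z (141 / 250).
  case: (bernstein4_ge0 z48 z56) => b0 b1 b2 b3 b4.
  apply: (@affine_le R _ _ (9 / 4) 3 d) => //; first by lra.
  - exact: ltW.
  - by move: b0 b1 b2 b3 b4; clear; lra.
  - by move: b0 b1 b2 b3 b4; clear; lra.
have z75 : z <= 19 / 25 by move: zd d3; clear; lra.
(* Interpolation needs distinct endpoints; if they are not, [d = 3]. *)
have [z3|z3] := ltrP (399 / 100 * z) 3; last first.
  have -> : d = 3 by apply/eqP; rewrite eq_le d3 (le_trans z3 zd).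
  case: (bernstein4_ge0 (ltW z56) z75) => b0 b1 b2 b3 b4.
  by move: b0 b1 b2 b3 b4; clear; lra.
apply: (@affine_le R _ _ (399 / 100 * z) 3 d) => //.
- case: (bernstein5_ge0 (ltW z56) z75) => b0 b1 b2 [b3 b4 b5].
  by move: b0 b1 b2 b3 b4 b5; clear; lra.
- case: (bernstein4_ge0 (ltW z56) z75) => b0 b1 b2 b3 b4.
  by move: b0 b1 b2 b3 b4; clear; lra.
Qed.

(* The thresholds on [z] are numerical: for [z] below them [lam := 0] works, above
   them either [lam := 1] or the value of [lam] that makes [P] disappear does. *)
Lemma clamp_gap (R : realFieldType) (d z P F : R) :
  clamp_system d z P F -> 101 / 100 * P <= F.
Proof.
move=> S; have z0 := csz0 S; have zd := cszd S.
(* Each range of [d] has its tail bound: [csP1] up to [49 / 50], [csP2] up to [63 / 50], [csP3] up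
   to [9 / 4], [csP4] up to [3]; beyond, [P = 0]. *)
have [d099|d099] := lerP d (49 / 50).
  have [d0|d0] := lerP d 0.
    have zz : z = 0 by lra.
    have d00 : d = 0 by lra.
    by have := csP1 S; have := csP0 S; have := csF0 S; rewrite zz d00; clear; lra.
  have [c0|c0] := lerP (63 / 50 * d - 3 / 4) 0.
    apply: (clamp_suff S (lexx 0)) => //; rewrite mul0r mulr0 !subr0.
    by apply: (@le_trans _ _ 0); [rewrite mulr_le0_ge0 // (csP0 S) | lra].
  apply: (@clamp_zero R d z P F (d + 1) 4) => //; try by clear S; lra.
  by rewrite [z * _]mulrC (csP1 S).
have [d3|d3] := lerP d 3; last by rewrite (csP5 S) // mulr0 (csF0 S).
have [d126|d126] := lerP d (63 / 50).
  have [zs|zs] := lerP z (8 / 27).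
    apply: (@clamp_zero R d z P F (2 * d - 1) (6 * (8 / 27))) => //; try lra.
    by have := ler_wpM2l z0 zs; have := csP2 S; clear; lra.
  by apply: (clamp_vanish (b := 21 / 25) S _ _ _ _ _ (ltW zs)); lra.
have [d225|d225] := lerP d (9 / 4); last first.
  have [zs|zs] := lerP z (12 / 25); last exact: clamp_one_high S d225 d3 (ltW zs).
  apply: (@clamp_zero R d z P F (d - 2) ((12 / 25) ^+ 3)) => //; try lra.
  apply: le_trans (csP4 S) _; rewrite exprS ler_wpM2l // lerXn2r ?nnegrE //.
  by clear; lra.
have [d128|d128] := lerP d (32 / 25).
  have [zs|zs] := lerP z (3 / 10); first by apply: (clamp_zero_mid S _ zs); lra.
  by apply: (clamp_vanish (b := 19 / 22) S _ _ _ _ _ (ltW zs)); lra.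
have [d132|d132] := lerP d (33 / 25).
  have [zs|zs] := lerP z (4 / 13); first by apply: (clamp_zero_mid S _ zs); lra.
  by apply: (clamp_vanish (b := 11 / 12) S _ _ _ _ _ (ltW zs)); lra.
have [d137|d137] := lerP d (11 / 8).
  have [zs|zs] := lerP z (8 / 25); first by apply: (clamp_zero_mid S _ zs); lra.
  by apply: (clamp_vanish (b := 1) S _ _ _ _ _ (ltW zs)); lra.
have [d15|d15] := lerP d (3 / 2).
  have [zs|zs] := lerP z (1 / 3); first by apply: (clamp_zero_mid S _ zs); lra.
  (* The upper end of the Bernstein interval comes from [zd] and the bound on [d]. *)
  have z2 : z <= 19 / 50 by lra.
  case: (bernstein4_ge0 (ltW zs) z2) => b0 b1 b2 b3 b4.
  by apply: (clamp_one_mid S _ _ (ltW d137) d15 (ltW zs));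
    [lra | lra | move: b0 b1 b2 b3 b4; clear; lra ..].
have [d18|d18] := lerP d (9 / 5).
  have [zs|zs] := lerP z (4 / 11); first by apply: (clamp_zero_mid S _ zs); lra.
  have z2 : z <= 23 / 50 by lra.
  case: (bernstein4_ge0 (ltW zs) z2) => b0 b1 b2 b3 b4.
  by apply: (clamp_one_mid S _ _ (ltW d15) d18);
    [lra | lra | lra | move: b0 b1 b2 b3 b4; clear; lra ..].
have [zs|zs] := lerP z (2 / 5); first by apply: (clamp_zero_mid S _ zs); lra.
have z2 : z <= 17 / 30 by lra.
case: (bernstein4_ge0 (ltW zs) z2) => b0 b1 b2 b3 b4.
by apply: (clamp_one_mid S _ _ (ltW d18) d225);
  [lra | lra | lra | move: b0 b1 b2 b3 b4; clear; lra ..].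
Qed.

(** * Averages over a finite set *)

Definition avg (R : realFieldType) (T : finType) (B : {set T}) (g : T -> R) : R :=
  (\sum_(a in B) g a) / #|B|%:R.

(** Nested averages model independent draws with repetition, so expectations factor; coincidences
    are paid for in [count4_le]. *)
Definition avg3 (R : realFieldType) (T : finType) (B : {set T})
    (g : T -> T -> T -> R) : R :=
  avg B (fun a => avg B (fun b => avg B (g a b))).

Definition avg4 (R : realFieldType) (T : finType) (B : {set T})
    (g : T -> T -> T -> T -> R) : R :=
  avg B (fun a => avg3 B (g a)).

Lemma eq_avg (R : realFieldType) (T : finType) (B : {set T}) (g h : T -> R) :
  g =1 h -> avg B g = avg B h.
Proof. by move=> gh; congr (_ / _); apply: eq_bigr => a _; rewrite gh. Qed.

Lemma avg_le (R : realFieldType) (T : finType) (B : {set T}) (g h : T -> R) :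
  (forall a, g a <= h a) -> avg B g <= avg B h.
Proof. by move=> gh; rewrite ler_wpM2r ?invr_ge0 // ler_sum. Qed.

Lemma avg_affine (R : realFieldType) (T : finType) (B : {set T}) (g : T -> R) u v :
  (0 < #|B|)%N -> avg B (fun a => u + v * g a) = u + v * avg B g.
Proof.
move=> B0; rewrite /avg big_split /= sumr_const -mulr_sumr mulrDl -mulrA; congr (_ + _).
by rewrite -[u *+ _]mulr_natr mulfK // pnatr_eq0 -lt0n.
Qed.

Lemma avg_const (R : realFieldType) (T : finType) (B : {set T}) (u : R) :
  (0 < #|B|)%N -> avg B (fun=> u) = u.
Proof.
move=> B0; rewrite -[RHS]addr0 -(mul0r (avg B (fun=> 0))) -avg_affine //.
by apply: eq_avg => a; rewrite mul0r addr0.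
Qed.

Lemma avgD (R : realFieldType) (T : finType) (B : {set T}) (g h : T -> R) :
  avg B (fun a => g a + h a) = avg B g + avg B h.
Proof. by rewrite /avg big_split mulrDl. Qed.

Lemma avgZ (R : realFieldType) (T : finType) (B : {set T}) (u : R) (g : T -> R) :
  avg B (fun a => u * g a) = u * avg B g.
Proof. by rewrite /avg -mulr_sumr mulrA. Qed.

Lemma avg_swap (R : realFieldType) (T : finType) (B : {set T}) (g : T -> T -> R) :
  avg B (fun a => avg B (g a)) = avg B (fun b => avg B (g^~ b)).
Proof. by rewrite /avg -!mulr_suml exchange_big. Qed.

Lemma avg3_le (R : realFieldType) (T : finType) (B : {set T})
    (g h : T -> T -> T -> R) :
  (forall a b c, g a b c <= h a b c) -> avg3 B g <= avg3 B h.
Proof. by move=> gh; do 3 apply: avg_le => ?. Qed.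

Lemma avg4_le (R : realFieldType) (T : finType) (B : {set T})
    (g h : T -> T -> T -> T -> R) :
  (forall a b c e, g a b c e <= h a b c e) -> avg4 B g <= avg4 B h.
Proof. by move=> gh; apply: avg_le => a; apply: avg3_le. Qed.

Lemma avg3D (R : realFieldType) (T : finType) (B : {set T})
    (g h : T -> T -> T -> R) :
  avg3 B (fun a b c => g a b c + h a b c) = avg3 B g + avg3 B h.
Proof.
rewrite /avg3 -avgD; apply: eq_avg => a; rewrite -avgD; apply: eq_avg => b.
by rewrite -avgD.
Qed.

Lemma avg4D (R : realFieldType) (T : finType) (B : {set T})
    (g h : T -> T -> T -> T -> R) :
  avg4 B (fun a b c e => g a b c e + h a b c e) = avg4 B g + avg4 B h.
Proof. by rewrite /avg4 -avgD; apply: eq_avg => a; rewrite -avg3D. Qed.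

Lemma avg3Z (R : realFieldType) (T : finType) (B : {set T}) (u : R)
    (g : T -> T -> T -> R) :
  avg3 B (fun a b c => u * g a b c) = u * avg3 B g.
Proof.
rewrite /avg3 -avgZ; apply: eq_avg => a; rewrite -avgZ; apply: eq_avg => b.
by rewrite -avgZ.
Qed.

Lemma avg4Z (R : realFieldType) (T : finType) (B : {set T}) (u : R)
    (g : T -> T -> T -> T -> R) :
  avg4 B (fun a b c e => u * g a b c e) = u * avg4 B g.
Proof. by rewrite /avg4 -avgZ; apply: eq_avg => a; rewrite -avg3Z. Qed.

(** In this interpolation form [ring] proves it for each variable of a multilinear polynomial. *)
Definition affine (R : realFieldType) (q : R -> R) : Prop :=
  forall t, q t = q 0 + (q 1 - q 0) * t.

Lemma avg_comp (R : realFieldType) (T : finType) (B : {set T}) (x : T -> R) q :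
  (0 < #|B|)%N -> affine q -> avg B (fun a => q (x a)) = q (avg B x).
Proof.
by move=> B0 aq; rewrite (aq (avg B x)) -avg_affine //; apply: eq_avg => a.
Qed.

(** By independence, the mean can be substituted for one variable at a time. *)
Lemma avg3_comp (R : realFieldType) (T : finType) (B : {set T}) (x : T -> R)
    (q : R -> R -> R -> R) :
  (0 < #|B|)%N ->
  (forall b c, affine (fun a => q a b c)) ->
  (forall a c, affine (fun b => q a b c)) ->
  (forall a b, affine (q a b)) ->
  avg3 B (fun a b c => q (x a) (x b) (x c)) = q (avg B x) (avg B x) (avg B x).
Proof.
move=> B0 q1 q2 q3; set z := avg B x.
rewrite -(@avg_comp R T B x (fun a => q a z z)) //; apply: eq_avg => a.
rewrite -(@avg_comp R T B x (fun b => q (x a) b z)) //; apply: eq_avg => b.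
by rewrite -avg_comp.
Qed.

Lemma avg4_comp (R : realFieldType) (T : finType) (B : {set T}) (x : T -> R)
    (q : R -> R -> R -> R -> R) :
  (0 < #|B|)%N ->
  (forall b c e, affine (fun a => q a b c e)) ->
  (forall a c e, affine (fun b => q a b c e)) ->
  (forall a b e, affine (fun c => q a b c e)) ->
  (forall a b c, affine (q a b c)) ->
  avg4 B (fun a b c e => q (x a) (x b) (x c) (x e)) =
    q (avg B x) (avg B x) (avg B x) (avg B x).
Proof.
move=> B0 q1 q2 q3 q4; set z := avg B x.
rewrite -(@avg_comp R T B x (fun a => q a z z z)) //; apply: eq_avg => a.
by rewrite -(@avg3_comp R T B x (q (x a))).
Qed.

(** Markov's inequality with a multilinear test function: [q] is nonnegative, and at least
    [u * (d + 1) - w] on the tail event. *)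
Lemma tail_le (R : realFieldType) (T : finType) (B : {set T}) (x : T -> R)
    (q : R -> R -> R -> R -> R) (u w d : R) :
  (0 < #|B|)%N -> 0 <= u -> (forall a, 0 <= x a <= 1) ->
  (forall b c e, affine (fun a => q a b c e)) ->
  (forall a c e, affine (fun b => q a b c e)) ->
  (forall a b e, affine (fun c => q a b c e)) ->
  (forall a b c, affine (q a b c)) ->
  (forall a b c e, 0 <= a <= 1 -> 0 <= b <= 1 -> 0 <= c <= 1 -> 0 <= e <= 1 ->
     0 <= q a b c e /\ u * (a + b + c + e) - w <= q a b c e) ->
  (u * (d + 1) - w) *
    avg4 B (fun a b c e => (d + 1 <= x a + x b + x c + x e)%R%:R) <=
  q (avg B x) (avg B x) (avg B x) (avg B x).
Proof.
move=> B0 u0 x01 q1 q2 q3 q4 Q.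
rewrite -avg4_comp // -avg4Z; apply: avg4_le => a b c e.
have [q0 qu] := Q _ _ _ _ (x01 a) (x01 b) (x01 c) (x01 e).
have [h|_] := lerP (d + 1) _; last by rewrite mulr0.
by rewrite mulr1; apply: le_trans qu; rewrite lerD2r ler_wpM2l.
Qed.

(** * Pointwise estimates on the unit cube *)

Lemma cube_le1 (R : realFieldType) (x : R) : 0 <= x <= 1 -> 0 <= x /\ 0 <= 1 - x.
Proof. by case/andP=> x0 x1; rewrite subr_ge0. Qed.

(** A multilinear polynomial is the sum of its vertex values times the products of variables and
    complements. Here a vertex with 0, 1, 2, 3, 4 ones has value 3, 1, 0, 0, 1. *)
Lemma e2_bounds (R : realFieldType) (a b c e : R) :
  0 <= a <= 1 -> 0 <= b <= 1 -> 0 <= c <= 1 -> 0 <= e <= 1 ->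
  0 <= a * b + a * c + a * e + b * c + b * e + c * e /\
  2 * (a + b + c + e) - 3 <= a * b + a * c + a * e + b * c + b * e + c * e.
Proof.
move=> /cube_le1[a0 a1] /cube_le1[b0 b1] /cube_le1[c0 c1] /cube_le1[e0 e1].
split; first by rewrite !addr_ge0 ?mulr_ge0.
rewrite -subr_ge0.
have -> : a * b + a * c + a * e + b * c + b * e + c * e -
    (2 * (a + b + c + e) - 3) =
  3 * ((1 - a) * (1 - b) * (1 - c) * (1 - e)) + a * (1 - b) * (1 - c) * (1 - e) +
  (1 - a) * b * (1 - c) * (1 - e) + (1 - a) * (1 - b) * c * (1 - e) +
  (1 - a) * (1 - b) * (1 - c) * e + a * b * c * e by ring.
by rewrite !addr_ge0 ?mulr_ge0.
Qed.

(** Same expansion; subtracting twice the product makes the affine bound exact at the vertex with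
    four ones. *)
Lemma e3_bounds (R : realFieldType) (a b c e : R) :
  0 <= a <= 1 -> 0 <= b <= 1 -> 0 <= c <= 1 -> 0 <= e <= 1 ->
  0 <= a * b * c + a * b * e + a * c * e + b * c * e - 2 * (a * b * c * e) /\
  1 * (a + b + c + e) - 2 <=
    a * b * c + a * b * e + a * c * e + b * c * e - 2 * (a * b * c * e).
Proof.
move=> /cube_le1[a0 a1] /cube_le1[b0 b1] /cube_le1[c0 c1] /cube_le1[e0 e1].
split.
  have -> : a * b * c + a * b * e + a * c * e + b * c * e - 2 * (a * b * c * e) =
    a * b * c * (1 - e) + a * b * (1 - c) * e + a * (1 - b) * c * e +
    (1 - a) * b * c * e + 2 * (a * b * c * e) by ring.
  by rewrite !addr_ge0 ?mulr_ge0.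
rewrite -subr_ge0.
have -> : a * b * c + a * b * e + a * c * e + b * c * e - 2 * (a * b * c * e) -
    (1 * (a + b + c + e) - 2) =
  2 * ((1 - a) * (1 - b) * (1 - c) * (1 - e)) + a * (1 - b) * (1 - c) * (1 - e) +
  (1 - a) * b * (1 - c) * (1 - e) + (1 - a) * (1 - b) * c * (1 - e) +
  (1 - a) * (1 - b) * (1 - c) * e by ring.
by rewrite !addr_ge0 ?mulr_ge0.
Qed.

Lemma e4_bounds (R : realFieldType) (a b c e : R) :
  0 <= a <= 1 -> 0 <= b <= 1 -> 0 <= c <= 1 -> 0 <= e <= 1 ->
  0 <= a * b * c * e /\ 1 * (a + b + c + e) - 3 <= a * b * c * e.
Proof.
move=> /cube_le1[a0 a1] /cube_le1[b0 b1] /cube_le1[c0 c1] /cube_le1[e0 e1].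
split; first by rewrite !mulr_ge0.
rewrite -subr_ge0.
have -> : a * b * c * e - (1 * (a + b + c + e) - 3) =
  (1 - a) * (1 - b) + ((1 - a) + a * (1 - b)) * (1 - c) +
  ((1 - a) + a * (1 - b) + a * b * (1 - c)) * (1 - e) by ring.
by do ![by [] | apply: addr_ge0 | apply: mulr_ge0].
Qed.

(** By symmetry of [w] every coordinate contributes the same average [Y], so both sides are
    [12 * Y]. *)
Lemma avg4_sym (R : realFieldType) (T : finType) (B : {set T}) (x : T -> R)
    (w : T -> T -> T -> T -> R) :
  (forall a b c e, w a b c e = w b a c e) ->
  (forall a b c e, w a b c e = w a c b e) ->
  (forall a b c e, w a b c e = w a b e c) ->
  4 * avg4 B (fun a b c e => (x a + x b + x c) * w a b c e) =
  3 * avg4 B (fun a b c e => (x a + x b + x c + x e) * w a b c e).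
Proof.
move=> w1 w2 w3.
set Y := avg4 B (fun a b c e => x a * w a b c e).
have Yb : avg4 B (fun a b c e => x b * w a b c e) = Y.
  rewrite /Y /avg4 /avg3 avg_swap; apply: eq_avg => a; apply: eq_avg => b.
  by apply: eq_avg => c; apply: eq_avg => e; rewrite w1.
have Yc : avg4 B (fun a b c e => x c * w a b c e) = Y.
  rewrite -Yb /avg4 /avg3; apply: eq_avg => a; rewrite avg_swap.
  by do 3 apply: eq_avg => ?; rewrite w2.
have Ye : avg4 B (fun a b c e => x e * w a b c e) = Y.
  rewrite -Yc /avg4 /avg3; apply: eq_avg => a; apply: eq_avg => b; rewrite avg_swap.
  by do 2 apply: eq_avg => ?; rewrite w3.
have S3 : avg4 B (fun a b c e => (x a + x b + x c) * w a b c e) = 3 * Y.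
  transitivity (Y + Y + Y); last by ring.
  rewrite -{2}Yb -{2}Yc -!avg4D.
  by do 4 apply: eq_avg => ?; ring.
have S4 : avg4 B (fun a b c e => (x a + x b + x c + x e) * w a b c e) = 4 * Y.
  transitivity (3 * Y + Y); last by ring.
  rewrite -S3 -[X in _ + X]Ye -!avg4D.
  by do 4 apply: eq_avg => ?; ring.
rewrite S3 S4; ring.
Qed.

(** If the sum [s] is below [D], the maximum is 0 and the product [p] is at least [1 - s], which
    suffices as [lam <= 1]. Otherwise the right side is 0, and the left side is nonpositive whether
    or not [s] reaches [d]. *)
Lemma clamp_pointwise (R : realFieldType) (a b c D d lam : R) :
  0 <= a <= 1 -> 0 <= b <= 1 -> 0 <= c <= 1 -> D <= d ->
  0 <= lam -> lam <= 1 -> lam <= d ->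
  D - (a + b + c) - lam * ((1 - a) * (1 - b) * (1 - c)) +
    Num.max (a + b + c - d) 0 <= (d - lam) * (a + b + c < D)%R%:R.
Proof.
move=> /cube_le1[a0 a1] /cube_le1[b0 b1] /cube_le1[c0 c1] Dd l0 l1 ld.
have p0 : 0 <= (1 - a) * (1 - b) * (1 - c) by rewrite !mulr_ge0.
have p1 : 1 - (a + b + c) <= (1 - a) * (1 - b) * (1 - c).
  rewrite -subr_ge0.
  have -> : (1 - a) * (1 - b) * (1 - c) - (1 - (a + b + c)) =
    a * b * (1 - c) + a * c + b * c by ring.
  by do ![by [] | apply: addr_ge0 | apply: mulr_ge0].
have s0 : 0 <= a + b + c by rewrite !addr_ge0.
move: ((1 - a) * (1 - b) * (1 - c)) (a + b + c) p0 p1 s0 => p s p0 p1 s0.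
have lp0 : 0 <= lam * p by apply: mulr_ge0.
have [sD|Ds] := ltrP s D.
  have -> : Num.max (s - d) 0 = 0.
    by apply/max_idPr; rewrite subr_le0 ltW // (lt_le_trans sD).
  have lp1 : lam * (1 - s) <= lam * p by apply: ler_wpM2l.
  have sl : 0 <= (1 - lam) * s by rewrite mulr_ge0 ?subr_ge0.
  by rewrite mulr1; move: lp1 sl Dd; clear; lra.
rewrite mulr0; have [ds|sd] := lerP d s.
  have -> : Num.max (s - d) 0 = s - d by apply/max_idPl; rewrite subr_ge0.
  by move: lp0 Dd; clear; lra.
have -> : Num.max (s - d) 0 = 0 by apply/max_idPr; rewrite subr_le0 ltW.
by move: lp0 Ds; clear; lra.
Qed.

(** * Comparison of the two probabilities *)

Definition tail4 (R : realFieldType) (T : finType) (B : {set T}) (x : T -> R) (t : R) : R :=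
  avg4 B (fun a b c e => (t <= x a + x b + x c + x e)%R%:R).

Definition lower3 (R : realFieldType) (T : finType) (A B : {set T}) (x D : T -> R) : R :=
  avg A (fun i => avg3 B (fun a b c => (x a + x b + x c < D i)%R%:R)).

Lemma avg_ge0 (R : realFieldType) (T : finType) (B : {set T}) (g : T -> R) :
  (forall a, 0 <= g a) -> 0 <= avg B g.
Proof. by move=> g0; rewrite divr_ge0 ?sumr_ge0. Qed.

(** On the tail event three of the four values carry, by symmetry, on average three quarters of a
    sum at least [d + 1], and [3 / 4 * (d + 1) - d = (3 - d) / 4]. *)
Lemma excess_lb (R : realFieldType) (T : finType) (B : {set T}) (x : T -> R) (d : R) :
  (0 < #|B|)%N ->
  (3 - d) / 4 * tail4 B x (d + 1) <=
    avg3 B (fun a b c => Num.max (x a + x b + x c - d) 0).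
Proof.
move=> B0; set w := fun a b c e => (d + 1 <= x a + x b + x c + x e)%R%:R : R.
have -> : tail4 B x (d + 1) = avg4 B w by [].
have sym := @avg4_sym R T B x w.
have {}sym : 4 * avg4 B (fun a b c e => (x a + x b + x c) * w a b c e) =
  3 * avg4 B (fun a b c e => (x a + x b + x c + x e) * w a b c e).
  apply: sym => a b c e; rewrite /w; congr (_ <= _)%R%:R; ring.
have h1 : (d + 1) * avg4 B w <= avg4 B (fun a b c e => (x a + x b + x c + x e) * w a b c e).
  rewrite -avg4Z; apply: avg4_le => a b c e; rewrite /w.
  by have [?|_] := lerP (d + 1) _; rewrite ?mulr1 ?mulr0.
have h2 : avg4 B (fun a b c e => (x a + x b + x c) * w a b c e) - d * avg4 B w <=
    avg3 B (fun a b c => Num.max (x a + x b + x c - d) 0).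
  rewrite -mulNr -avg4Z -avg4D /avg4 /avg3.
  do 3 apply: avg_le => ?; rewrite -[leRHS](avg_const _ B0); apply: avg_le => ?.
  rewrite -mulrDl /w; case: (d + 1 <= _); rewrite ?mulr1 ?mulr0.
    by rewrite le_max lexx.
  by rewrite le_max lexx orbT.
by move: h1 h2 sym; clear; lra.
Qed.

(** The bounds on [P] are [tail_le] applied to the elementary symmetric polynomials; [csF] is the
    average of [clamp_pointwise] combined with [excess_lb]. *)
Lemma clamp_system_avg (R : realFieldType) (T : finType) (A B : {set T})
    (x D : T -> R) (d tau : R) :
  (0 < #|A|)%N -> (0 < #|B|)%N -> (forall a, 0 <= x a <= 1) ->
  (forall i, D i <= d) -> 0 <= d -> 399 / 100 * avg B x <= d ->
  0 <= tau -> tau <= 1 -> 399 / 100 * avg B x <= tau * avg A D ->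
  clamp_system d (avg B x) (tail4 B x (d + 1)) (tau * lower3 A B x D).
Proof.
move=> A0 B0 x01 Dd d0 zd t0 t1 tD; set z := avg B x; set P := tail4 _ _ _.
have z0 : 0 <= z by apply: avg_ge0 => a; case/andP: (x01 a).
have z1 : z <= 1.
  by rewrite -(avg_const 1 B0); apply: avg_le => a; case/andP: (x01 a).
have P0 : 0 <= P by do 4 apply: avg_ge0 => ?.
have T1 : (d + 1) * P <= 4 * z.
  have := @tail_le R T B x (fun a b c e => a + b + c + e) 1 0 d B0 ler01 x01.
  rewrite mul1r subr0 -/z; move=> H; apply: le_trans (H _ _ _ _ _) _.
  1-4: by move=> a b c t; ring.
    move=> a b c e /andP[a0 _] /andP[b0 _] /andP[c0 _] /andP[e0 _].
    by rewrite mul1r subr0 !addr_ge0.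
  by clear; lra.
have two0 : 0 <= 2 :> R by [].
split => //.
- have := @tail_le R T B x
    (fun a b c e => a * b + a * c + a * e + b * c + b * e + c * e) 2 3 d B0 two0 x01.
  rewrite -/z => H; have {}H := H _ _ _ _ (@e2_bounds R).
  rewrite [6 * _](_ : _ = z * z + z * z + z * z + z * z + z * z + z * z); last by ring.
  rewrite [2 * d - 1](_ : _ = 2 * (d + 1) - 3); last by ring.
  by apply: H => a b c t; ring.
- have := @tail_le R T B x (fun a b c e =>
    a * b * c + a * b * e + a * c * e + b * c * e - 2 * (a * b * c * e))
    1 2 d B0 ler01 x01.
  rewrite -/z => H; have {}H := H _ _ _ _ (@e3_bounds R).
  rewrite [4 * _ - _](_ : _ =
    z * z * z + z * z * z + z * z * z + z * z * z - 2 * (z * z * z * z)); last by ring.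
  rewrite [d - 1](_ : _ = 1 * (d + 1) - 2); last by ring.
  by apply: H => a b c t; ring.
- have := @tail_le R T B x (fun a b c e => a * b * c * e) 1 3 d B0 ler01 x01.
  rewrite -/z => H; have {}H := H _ _ _ _ (@e4_bounds R).
  rewrite [z ^+ 4](_ : _ = z * z * z * z); last by ring.
  rewrite [d - 2](_ : _ = 1 * (d + 1) - 3); last by ring.
  by apply: H => a b c t; ring.
- move=> d3; apply: etrans (avg_const 0 B0); apply: eq_avg => a.
  apply: etrans (avg_const 0 B0); apply: eq_avg => b.
  apply: etrans (avg_const 0 B0); apply: eq_avg => c.
  apply: etrans (avg_const 0 B0); apply: eq_avg => e.
  case: lerP => // h; exfalso.
  case/andP: (x01 a) (x01 b) (x01 c) (x01 e) => _ h1.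
  move=> /andP[_ h2] /andP[_ h3] /andP[_ h4].
  by move: h h1 h2 h3 h4 d3; clear; lra.
- by apply: mulr_ge0 => //; do 4 apply: avg_ge0 => ?.
move=> lam l0 l1 ld.
have main : avg A D - 3 * z - lam * (1 - z) ^+ 3 + (3 - d) / 4 * P <=
    (d - lam) * lower3 A B x D.
  rewrite /lower3 -avgZ.
  pose K i := avg3 B (fun a b c => D i - (x a + x b + x c) -
    lam * ((1 - x a) * (1 - x b) * (1 - x c)) + Num.max (x a + x b + x c - d) 0).
  apply: le_trans (_ : avg A K <= _); last first.
    apply: avg_le => i; rewrite -avg3Z; apply: avg3_le => a b c.
    exact: clamp_pointwise.
  set M := avg3 B (fun a b c => Num.max (x a + x b + x c - d) 0).
  have KE i : K i = (M - 3 * z - lam * (1 - z) ^+ 3) + 1 * D i.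
    rewrite /K avg3D (@avg3_comp R T B x (fun a b c => D i - (a + b + c) -
      lam * ((1 - a) * (1 - b) * (1 - c)))) //.
    - by rewrite -/z -/M; ring.
    - by move=> a b t; ring.
    - by move=> a b t; ring.
    - by move=> a b t; ring.
  rewrite (eq_avg _ KE) avg_affine //.
  have := @excess_lb R T B x d B0; rewrite -/M -/P; clear; lra.
(* The amount subtracted from [avg A D] in [main] is nonnegative, so multiplying it by [tau <= 1]
   only helps. *)
have K0 : 0 <= 3 * z + lam * (1 - z) ^+ 3 - (3 - d) / 4 * P.
  have : 0 <= lam * (1 - z) ^+ 3 by rewrite mulr_ge0 ?exprn_ge0 ?subr_ge0.
  have : 0 <= d * P by apply: mulr_ge0.
  by move: T1; clear; lra.
rewrite [leRHS]mulrCA; apply: le_trans _ (ler_wpM2l t0 main).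
have : 0 <= (1 - tau) * (3 * z + lam * (1 - z) ^+ 3 - (3 - d) / 4 * P).
  by apply: mulr_ge0 => //; rewrite subr_ge0.
by move: tD; rewrite -/z; clear; lra.
Qed.

(* A factor [tau < 1] reduces the case where [B] has more than [4 #|A|] elements
   to the balanced one. *)
Lemma lower3_tail4 (R : realFieldType) (T : finType) (A B : {set T})
    (x D : T -> R) (d : R) :
  (0 < #|A|)%N -> (0 < #|B|)%N -> 399 / 100 * #|A|%:R <= #|B|%:R :> R ->
  (forall a, 0 <= x a <= 1) -> (forall i, D i <= d) -> 0 <= d ->
  \sum_(b in B) x b <= \sum_(i in A) D i ->
  101 / 100 * #|B|%:R * tail4 B x (d + 1) <= 4 * #|A|%:R * lower3 A B x D.
Proof.
move=> A0 B0 AB x01 Dd d0 xD.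
set nA : R := #|A|%:R in AB *; set nB : R := #|B|%:R in AB *.
have nA0 : 0 < nA by rewrite ltr0n.
have nB0 : 0 < nB by rewrite ltr0n.
have z0 : 0 <= avg B x by apply: avg_ge0 => a; case/andP: (x01 a).
have DE : nB * avg B x <= nA * avg A D.
  by rewrite /avg !(mulrC _ (_ / _)) !divfK ?gt_eqF.
have D_le : avg A D <= d by rewrite -(avg_const d A0); apply: avg_le.
have zd : 399 / 100 * avg B x <= d.
  apply: le_trans D_le; rewrite -(ler_pM2l nA0).
  apply: le_trans DE; rewrite mulrA; apply: ler_wpM2r => //.
  by rewrite mulrC.
have P0 : 0 <= tail4 B x (d + 1) by do 4 apply: avg_ge0 => ?.
have F0 : 0 <= lower3 A B x D by do 4 apply: avg_ge0 => ?.
have [nBA|nAB] := lerP nB (4 * nA).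
  have S : clamp_system d (avg B x) (tail4 B x (d + 1)) (1 * lower3 A B x D).
    apply: clamp_system_avg => //; rewrite mul1r -(ler_pM2l nA0).
    by apply: le_trans DE; rewrite mulrA; apply: ler_wpM2r => //; rewrite mulrC.
  have := clamp_gap S; rewrite mul1r => G.
  have h1 := ler_wpM2r P0 nBA.
  have nA40 : 0 <= 4 * nA by rewrite mulr_ge0 // ltW.
  have h2 := ler_wpM2l nA40 G.
  by move: h1 h2; clear; lra.
have tau0 : 0 <= 4 * nA / nB by rewrite divr_ge0 ?mulr_ge0 // ltW.
have S : clamp_system d (avg B x) (tail4 B x (d + 1)) (4 * nA / nB * lower3 A B x D).
  apply: clamp_system_avg => //; first by rewrite ler_pdivrMr // mul1r ltW.
  apply: (@le_trans _ _ (4 * avg B x)); first by apply: ler_wpM2r => //; lra.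
  rewrite mulrAC ler_pdivlMr //; move: DE; clear; lra.
by have := clamp_gap S; rewrite [leRHS]mulrAC ler_pdivlMr // mulrAC.
Qed.

(** * Fractional vertex covers *)

(** Induction on the number of constraints. With none, testing [x := g] forces [g = 0]. *)
Lemma farkas_ord (R : realFieldType) (I : finType) (m : nat)
    (A : 'I_m -> I -> R) (g : I -> R) :
  (forall x : I -> R, (forall j, \sum_i A j i * x i <= 0) -> \sum_i g i * x i <= 0) ->
  exists2 u : 'I_m -> R, (forall j, 0 <= u j) & forall i, g i = \sum_j u j * A j i.
Proof.
elim: m A g => [|m IH] A g H.
  exists (fun=> 0) => // i; rewrite big_ord0.
  have /H g2 : forall j : 'I_0, \sum_i A j i * g i <= 0 by case.
  have g20 j : predT j -> 0 <= g j * g j by rewrite -expr2 sqr_ge0.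
  have /eqP : \sum_i g i * g i = 0 by apply/eqP; rewrite eq_le g2 sumr_ge0.
  by rewrite psumr_eq0 // => /allP/(_ i); rewrite mem_index_enum mulf_eq0 orbb => /(_ isT)/eqP.
pose A' j := A (lift ord0 j).
(* If the other constraints already imply the conclusion, constraint 0 gets multiplier 0. Otherwise
   some [y] satisfies them with [g] positive at [y], so [a] is positive there too. *)
have [h|/existsNP[y /not_implyP[Ay /negP]]] :=
    pselect (forall x, (forall j, \sum_i A' j i * x i <= 0) -> \sum_i g i * x i <= 0).
  have [u u0 gu] := IH A' g h.
  exists (fun j => if unlift ord0 j is Some k then u k else 0).
    by move=> j; case: unliftP.
  move=> i; rewrite big_ord_recl unlift_none mul0r add0r gu.
  by apply: eq_bigr => j _; rewrite liftK.
rewrite -ltNge => gy.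
set a := A ord0; set t := \sum_i a i * y i.
have t0 : 0 < t.
  rewrite ltNge; apply/negP => t0; move: gy; rewrite ltNge H // => j.
  by case: (unliftP ord0 j) => [k|] ->; [exact: Ay | exact: t0].
have tn0 : t != 0 by rewrite gt_eqF.
(* [proj f] is [f] composed with the projection along [y] onto the hyperplane where [a] vanishes;
   this eliminates constraint 0. *)
pose proj (f : I -> R) i := f i - (\sum_k f k * y k) / t * a i.
have projE f x : \sum_i proj f i * x i =
    \sum_i f i * (x i - (\sum_k a k * x k) / t * y i).
  rewrite (eq_bigr (fun i => f i * x i - (\sum_k f k * y k) / t * (a i * x i))); last first.
    by move=> i _; rewrite mulrBl mulrA.
  rewrite [RHS](eq_bigr (fun i => f i * x i - (\sum_k a k * x k) / t * (f i * y i))); last first.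
    by move=> i _; rewrite mulrBr mulrCA.
  by rewrite !sumrB -!mulr_sumr; congr (_ - _); ring.
have [|u u0 gu] := IH (fun j => proj (A' j)) (proj g).
  move=> x Bx; rewrite projE; apply: H => j.
  case: (unliftP ord0 j) => [k|] ->; first by rewrite -projE; exact: Bx.
  rewrite -[A ord0]/a -projE (eq_bigr (fun=> 0)) ?big1_eq // => i _.
  by rewrite /proj divff // mul1r subrr mul0r.
(* The multiplier of [a]. It is nonnegative: [g] is positive at [y] and each [A' j] is nonpositive
   there. *)
set b := (\sum_k g k * y k) / t - \sum_j u j * ((\sum_k A' j k * y k) / t).
exists (fun j => if unlift ord0 j is Some k then u k else b).
  move=> j; case: unliftP => // _; rewrite /b subr_ge0.
  apply: (@le_trans _ _ 0); last by rewrite divr_ge0 // ltW.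
  apply: sumr_le0 => k _; apply: mulr_ge0_le0 => //.
  by apply: mulr_le0_ge0; [exact: Ay | rewrite invr_ge0 ltW].
move=> i; rewrite big_ord_recl unlift_none -[A ord0]/a.
rewrite (eq_bigr (fun j => u j * proj (A' j) i + u j * ((\sum_k A' j k * y k) / t) * a i)).
  by rewrite big_split /= -gu -mulr_suml /proj /b; ring.
by move=> j _; rewrite liftK /proj /A'; ring.
Qed.

Lemma farkas (R : realFieldType) (I J : finType) (A : J -> I -> R) (g : I -> R) :
  (forall x : I -> R, (forall j, \sum_i A j i * x i <= 0) -> \sum_i g i * x i <= 0) ->
  exists2 u : J -> R, (forall j, 0 <= u j) & forall i, g i = \sum_j u j * A j i.
Proof.
move=> H; have [|u u0 gu] := @farkas_ord R I _ (fun k : 'I_#|J| => A (enum_val k)) g.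
  by move=> x Ax; apply: H => j; have := Ax (enum_rank j); rewrite enum_rankK.
exists (fun j => u (enum_rank j)) => // i; rewrite gu.
rewrite [RHS](reindex_onto enum_val enum_rank) => [|j _]; last exact: enum_rankK.
apply: eq_big => [k|k _]; first by rewrite enum_valK eqxx.
by rewrite enum_valK.
Qed.

Lemma fractional_matching_number_ub (R : realType) (n : nat) (G : {set {set 'I_n}})
    (phi : {set 'I_n} -> R) :
  fractional_matching G phi -> matching_size G phi <= fractional_matching_number R G.
Proof.
move=> Gphi; apply: ub_le_sup; last by exists phi.
exists #|G|%:R => _ [psi [psi01 _] ->]; rewrite /matching_size -sumr_const.
by apply: ler_sum => e /psi01/andP[].
Qed.

(** LP duality: Farkas' lemma is applied to the cone of homogenized fractional matchings, and the
    multipliers of the load constraints form the cover. *)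
Lemma fractional_cover (R : realType) (n : nat) (G : {set {set 'I_n}}) (s : R) :
  (forall e, e \in G -> e != set0) -> fractional_matching_number R G <= s ->
  exists w : 'I_n -> R, [/\ forall v, 0 <= w v, \sum_v w v <= s &
    forall e, e \in G -> 1 <= \sum_(v in e) w v].
Proof.
move=> Gn0 nu_s.
(* The coordinate [None] is the common bound on the loads of the vertices. *)
pose A (j : option {set 'I_n} + 'I_n) (i : option {set 'I_n}) : R :=
  match j, i with
  | inl k, _ => - (k == i)%:R
  | inr v, Some e => ((e \in G) && (v \in e))%:R
  | inr v, None => -1
  end.
pose g (i : option {set 'I_n}) : R := if i is Some e then (e \in G)%:R else - s.
have sum_opt (f : option {set 'I_n} -> R) : \sum_i f i = f None + \sum_e f (Some e).
  rewrite (bigD1 None) //=; congr (_ + _).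
  rewrite (reindex_onto (@Some _) (fun i => odflt set0 i)) => [|[]//].
  by apply: eq_bigl => e; rewrite /= eqxx.
have [x Ax|u u0 gu] := @farkas R _ _ A g.
  have x0 i : 0 <= x i.
    have := Ax (inl i); rewrite (bigD1 i) //= eqxx big1 ?addr0 ?mulN1r ?oppr_le0 //.
    by move=> k /negPf ki; rewrite eq_sym ki oppr0 mul0r.
  have load v : \sum_(e in G | v \in e) x (Some e) <= x None.
    have := Ax (inr v); rewrite sum_opt /= mulN1r addrC subr_le0; congr (_ <= _).
    rewrite [RHS]big_mkcond; apply: eq_bigr => e _; case: ifP => _; last by rewrite mul0r.
    by rewrite mul1r.
  have x_le e : e \in G -> x (Some e) <= x None.
    move=> eG; have /set0Pn[v ve] := Gn0 e eG; apply: le_trans (load v).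
    by rewrite (bigD1 e) ?eG //= lerDl sumr_ge0.
  have -> : \sum_i g i * x i = \sum_(e in G) x (Some e) - s * x None.
    rewrite sum_opt /= mulNr addrC; congr (_ - _).
    rewrite [RHS]big_mkcond; apply: eq_bigr => e _; case: ifP => _; last by rewrite mul0r.
    by rewrite mul1r.
  (* If the common bound is 0, all weights on [G] vanish; otherwise dividing by it gives a
     fractional matching. *)
  rewrite subr_le0; have [tau0|] := ltrP 0 (x None); last first.
    move=> tau0; have tau : x None = 0 by apply/eqP; rewrite eq_le tau0 x0.
    rewrite tau mulr0 sumr_le0 // => e eG; rewrite -tau; exact: x_le.
  have fm : fractional_matching G (fun e => x (Some e) / x None).
    split=> [e eG|v]; last by rewrite -mulr_suml ler_pdivrMr // mul1r load.
    by rewrite divr_ge0 //= ler_pdivrMr // mul1r x_le.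
  have := le_trans (fractional_matching_number_ub fm) nu_s.
  by rewrite /matching_size -mulr_suml ler_pdivrMr.
have sumA i : g i = - u (inl i) + \sum_v u (inr v) * A (inr v) i.
  rewrite gu big_sumType /=; congr (_ + _).
  rewrite (bigD1 i) //= eqxx mulrN1 big1 ?addr0 // => k /negPf ->.
  by rewrite oppr0 mulr0.
(* Coordinate [None] gives the total weight, coordinate [Some e] the covering of [e]; the
   multipliers [u (inl _)] are the slacks. *)
exists (fun v => u (inr v)); split=> // [|e eG].
  have := sumA None; have := u0 (inl None); rewrite /= -mulr_suml mulrN1; lra.
have := sumA (Some e); have := u0 (inl (Some e)); rewrite /= eG /=.
have -> : \sum_v u (inr v) * (v \in e)%:R = \sum_(v in e) u (inr v).
  rewrite [RHS]big_mkcond; apply: eq_bigr => v _; case: ifP => _; last by rewrite mulr0.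
  by rewrite mulr1.
lra.
Qed.

(** The enumerations in [is_stable] need not be increasing, so [b] may differ from [a] in the single
    value [j]. *)
Lemma stable_shift (k n : nat) (G : {set {set 'I_n}}) (e : {set 'I_n}) (i j : 'I_n) :
  is_kgraph k G -> is_stable k G -> e \in G -> j \in e -> i \notin e ->
  (i <= j)%N -> i |: (e :\ j) \in G.
Proof.
move=> Gk Gs eG je ie ij; have ek : k = #|e| by rewrite (Gk e eG).
pose a (t : 'I_k) := enum_val (cast_ord ek t).
have a_in t : a t \in e by exact: enum_valP.
have a_onto v : v \in e -> exists t, v = a t.
  move=> ve; exists (cast_ord (esym ek) (enum_rank_in ve v)).
  by rewrite /a cast_ordKV enum_rankK_in.
have aE : [set a t | t : 'I_k] = e.
  apply/setP => v; apply/imsetP/idP => [[t _ ->]//|/a_onto[t ->]]; by exists t.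
pose b t := if a t == j then i else a t.
have bE : [set b t | t : 'I_k] = i |: (e :\ j).
  apply/setP => v; apply/imsetP/idP => [[t _ ->]|].
    rewrite /b; case: eqVneq => [_|atj]; first by rewrite setU11.
    by rewrite !inE atj a_in orbT.
  rewrite !inE => /orP[/eqP ->|/andP[vj /a_onto[t vt]]].
    by have [t jt] := a_onto j je; exists t => //; rewrite /b -jt eqxx.
  by exists t => //; rewrite /b -vt (negPf vj).
rewrite -bE; apply: (Gs a b); first by rewrite aE.
  rewrite bE cardsU1 !inE (negPf ie) andbF /= ek [in RHS](cardsD1 j) je.
  by [].
by move=> t; rewrite /b; case: eqP => [->|].
Qed.

Lemma sum_tperm (R : numDomainType) (T : finType) (f : T -> R) (e : {set T}) (i j : T) :
  \sum_(v in e) f (tperm i j v) = \sum_(v in tperm i j @: e) f v.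
Proof. by rewrite big_imset //=; apply: in2W; exact: perm_inj. Qed.

(** An edge without [j] can only gain weight; one containing both vertices keeps its weight; one
    containing only [j] gets the weight of its shift, which is an edge by stability. *)
Lemma cover_shift (R : numDomainType) (k n : nat) (G : {set {set 'I_n}}) (f : 'I_n -> R)
    (i j : 'I_n) :
  is_kgraph k G -> is_stable k G -> (i <= j)%N -> f i <= f j ->
  (forall e, e \in G -> 1 <= \sum_(v in e) f v) ->
  forall e, e \in G -> 1 <= \sum_(v in e) f (tperm i j v).
Proof.
move=> Gk Gs ij fij cov e eG.
have [je|je] := boolP (j \in e); last first.
  apply: le_trans (cov e eG) _; apply: ler_sum => v ve.
  by case: tpermP => [->|vj|//] //; rewrite -vj ve in je.
rewrite sum_tperm; apply: cov.
have [ie|ie] := boolP (i \in e).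
  suff -> : tperm i j @: e = e by [].
  apply/setP => v; apply/imsetP/idP => [[u ue ->]|ve]; first by case: tpermP.
  by exists (tperm i j v); rewrite ?tpermK //; case: tpermP.
suff -> : tperm i j @: e = i |: (e :\ j) by exact: stable_shift Gk Gs eG je ie ij.
apply/setP => v; apply/imsetP/idP => [[u ue ->]|].
  case: tpermP => [ui|_|/eqP ui /eqP uj]; first by rewrite ui (negPf ie) in ue.
    by rewrite setU11.
  by rewrite !inE uj ue orbT.
rewrite !inE => /orP[/eqP ->|/andP[vj ve]]; first by exists j; rewrite ?tpermR.
exists v => //; rewrite tpermD // eq_sym //.
by apply: contraNneq ie => <-.
Qed.

Lemma sorted_cover (R : realFieldType) (k n : nat) (G : {set {set 'I_n}}) (w : 'I_n -> R) :
  is_kgraph k G -> is_stable k G ->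
  (forall e, e \in G -> 1 <= \sum_(v in e) w v) ->
  exists2 p : {perm 'I_n}, (forall e, e \in G -> 1 <= \sum_(v in e) w (p v)) &
    forall i j : 'I_n, (i <= j)%N -> w (p j) <= w (p i).
Proof.
move=> Gk Gs cov.
pose P (p : {perm 'I_n}) := [forall e in G, 1 <= \sum_(v in e) w (p v)].
have P1 : P 1%g.
  by apply/forall_inP => e /cov; under [in X in _ -> X]eq_bigr do rewrite perm1.
(* Among the rearrangements of [w] that are covers, the one maximizing [F] is
   nonincreasing: exchanging the values of an inversion increases [F]. *)
pose F (p : {perm 'I_n}) : R := \sum_(v : 'I_n) - (v : nat)%:R * w (p v).
have [p Pp pmax] := Order.TotalTheory.arg_maxP F P1.
exists p; first by move=> e eG; exact: (forall_inP Pp).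
move=> i j ij; rewrite leNgt; apply/negP => wij.
have ij' : i != j by apply: contraTneq wij => ->; rewrite ltxx.
have := pmax (tperm i j * p)%g.
have -> : P (tperm i j * p)%g.
  apply/forall_inP => e eG; under eq_bigr do rewrite permM.
  apply: (cover_shift (f := fun v => w (p v)) Gk Gs ij) (eG) => //; first exact: ltW.
  exact: (forall_inP Pp).
move=> /(_ isT); apply/negP; rewrite -ltNge /F.
rewrite (bigD1 i) // (bigD1 j) ?[j == i]eq_sym //=.
rewrite [ltRHS](bigD1 i) // [X in _ < _ + X](bigD1 j) ?[j == i]eq_sym //=.
rewrite !permM tpermL tpermR.
rewrite [in ltRHS](eq_bigr (fun v : 'I_n => - (v : nat)%:R * w (p v))); last first.
  by move=> v /andP[vi vj]; rewrite permM tpermD // eq_sym.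
have ijR : (i : nat)%:R < (j : nat)%:R :> R by rewrite ltr_nat ltn_neqAle ij' ij.
(* This product is the increase of [F] under the exchange. *)
have : 0 < ((j : nat)%:R - (i : nat)%:R) * (w (p j) - w (p i)).
  by rewrite mulr_gt0 ?subr_gt0.
move: (\sum_(_ | _) _) => X; clear; lra.
Qed.

(** Truncating at 1 keeps a cover, since one vertex of weight 1 covers its edges; the truncated
    weights are then sorted. *)
Lemma monotone_cover (R : realType) (n : nat) (G : {set {set 'I_n}}) (s : R) :
  is_kgraph 4 G -> is_stable 4 G -> fractional_matching_number R G <= s ->
  exists w : 'I_n -> R, [/\ forall v, 0 <= w v <= 1,
    forall i j : 'I_n, (i <= j)%N -> w j <= w i, \sum_v w v <= s &
    forall e, e \in G -> 1 <= \sum_(v in e) w v].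
Proof.
move=> Gk Gs nu_s.
have [e eG|w [w0 ws wG]] := fractional_cover _ nu_s.
  by rewrite -card_gt0 (Gk e eG).
have cov e : e \in G -> 1 <= \sum_(v in e) Num.min (w v) 1.
  move=> eG; have [/existsP[v /andP[ve wv]]|] := boolP [exists v, (v \in e) && (1 <= w v)].
    rewrite (bigD1 v) //= min_r // lerDl sumr_ge0 // => u _.
    by rewrite le_min w0 ler01.
  rewrite negb_exists => /forallP H; apply: le_trans (wG e eG) _.
  apply: ler_sum => v ve; rewrite min_l //.
  by have := H v; rewrite ve -ltNge => /ltW.
have [p covp mono] := sorted_cover Gk Gs cov.
exists (fun v => Num.min (w (p v)) 1); split => //.
  by move=> v; rewrite le_min w0 ler01 ge_min lexx orbT.
apply: le_trans ws; rewrite [leRHS](reindex_inj (@perm_inj _ p)) /=.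
by apply: ler_sum => v _; rewrite ge_min lexx.
Qed.

(** * Counting ordered quadruples *)

Lemma sum_distinct3 (T : finType) (X : {set T}) :
  (\sum_a \sum_b \sum_c [&& a \in X, b \in X :\ a & c \in X :\ a :\ b] =
    #|X| * (#|X|.-1 * #|X|.-2))%N.
Proof.
transitivity (\sum_(a in X) \sum_(b in X :\ a) \sum_(c in X :\ a :\ b) 1)%N.
  rewrite [RHS]big_mkcond; apply: eq_bigr => a _; case: ifP => aX; last first.
    by rewrite big1 // => b _; rewrite big1.
  rewrite [RHS]big_mkcond; apply: eq_bigr => b _; case: ifP => bX; last first.
    by rewrite big1.
  by rewrite [RHS]big_mkcond; apply: eq_bigr => c _; case: ifP.
rewrite (eq_bigr (fun=> #|X|.-1 * #|X|.-2)%N) ?sum_nat_const // => a aX.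
have Xa : #|X :\ a| = #|X|.-1 by rewrite [in RHS](cardsD1 a) aX.
rewrite (eq_bigr (fun=> #|X|.-2)) ?sum_nat_const ?Xa // => b bX.
by rewrite sum1_card -[#|X|.-2]/(#|X|.-1.-1) -Xa [in RHS](cardsD1 b) bX.
Qed.

(** For a 4-set [e], this says that [a, b, c, d] is an ordering of [e]; successive deletions suit
    [big_setD1]. *)
Definition enum4 (T : finType) (e : {set T}) (a b c d : T) : bool :=
  (a \in e) && [&& b \in e :\ a, c \in e :\ a :\ b & d \in e :\ a :\ b :\ c].

Lemma enum4_exhausts (T : finType) (e : {set T}) (a b c d : T) :
  #|e| = 4%N -> enum4 e a b c d -> e :\ a :\ b :\ c :\ d = set0.
Proof.
move=> e4 /and4P[ae be ce de]; apply/eqP; rewrite -cards_eq0.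
have := cardsD1 a e; rewrite ae e4 => /eqP; rewrite add1n eqSS => /eqP.
rewrite (cardsD1 b (e :\ a)) be => /eqP; rewrite add1n eqSS => /eqP.
rewrite (cardsD1 c (e :\ a :\ b)) ce => /eqP; rewrite add1n eqSS => /eqP.
by rewrite (cardsD1 d (e :\ a :\ b :\ c)) de => /eqP; rewrite add1n eqSS eq_sym.
Qed.

Lemma enum4E (T : finType) (e : {set T}) (a b c d : T) :
  #|e| = 4%N -> enum4 e a b c d -> e = a |: (b |: (c |: [set d])).
Proof.
move=> e4 eE; have e0 := enum4_exhausts e4 eE; case/and4P: eE => ae be ce de.
by rewrite -(setD1K ae) -(setD1K be) -(setD1K ce) -(setD1K de) e0 setU0.
Qed.

Lemma sum_enum4E (V : nmodType) (T : finType) (e : {set T}) (a b c d : T) (w : T -> V) :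
  #|e| = 4%N -> enum4 e a b c d -> \sum_(v in e) w v = w a + w b + w c + w d.
Proof.
move=> e4 eE; have e0 := enum4_exhausts e4 eE; case/and4P: eE => ae be ce de.
rewrite (big_setD1 a) // (big_setD1 b) // (big_setD1 c) // (big_setD1 d) //= e0.
by rewrite big_set0 addr0 !addrA.
Qed.

Lemma enum4_set (T : finType) (a b c d : T) :
  a != b -> a != c -> a != d -> b != c -> b != d -> c != d ->
  #|[set a; b; c; d]| = 4%N /\ enum4 [set a; b; c; d] a b c d.
Proof.
move=> ab ac ad bc bd cd; split.
  rewrite -!setUA !cardsU1 cards1 !inE !negb_or.
  by rewrite ab ac ad bc bd cd.
rewrite /enum4 !inE !eqxx !orbT /= [b == a]eq_sym [c == a]eq_sym [d == a]eq_sym.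
by rewrite [c == b]eq_sym [d == b]eq_sym [d == c]eq_sym ab ac ad bc bd cd.
Qed.

Lemma sum_enum4 (T : finType) (e : {set T}) :
  #|e| = 4%N -> (\sum_a \sum_b \sum_c \sum_d enum4 e a b c d = 24)%N.
Proof.
move=> e4; transitivity (\sum_(a in e) 6)%N; last by rewrite sum_nat_const e4.
rewrite [RHS]big_mkcond; apply: eq_bigr => a _; rewrite /enum4; case: ifP => ae /=.
  rewrite sum_distinct3; have := cardsD1 a e; rewrite ae e4 add1n => -[<-] //.
by rewrite big1 // => b _; rewrite big1 // => c _; rewrite big1.
Qed.

(** Each edge has 24 orderings, and a quadruple orders at most one edge. *)
Lemma count4_ge (T : finType) (Q : {set {set T}}) (P : T -> T -> T -> T -> bool) :
  (forall e, e \in Q -> #|e| = 4%N) ->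
  (forall e a b c d, e \in Q -> enum4 e a b c d -> P a b c d) ->
  (24 * #|Q| <= \sum_a \sum_b \sum_c \sum_d P a b c d)%N.
Proof.
move=> Q4 QP; rewrite mulnC -sum_nat_const.
rewrite (eq_bigr (fun e => \sum_a \sum_b \sum_c \sum_d enum4 e a b c d)%N); last first.
  by move=> e eQ; rewrite sum_enum4 ?Q4.
rewrite exchange_big; apply: leq_sum => a _; rewrite exchange_big; apply: leq_sum => b _.
rewrite exchange_big; apply: leq_sum => c _; rewrite exchange_big; apply: leq_sum => d _.
have [/existsP[e /andP[eQ eE]]|] := boolP [exists e, (e \in Q) && enum4 e a b c d].
  rewrite (QP e a b c d) // (bigD1 e) //= eE big1 // => e' /andP[e'Q e'e].
  case: (boolP (enum4 e' a b c d)) => // e'E; case/eqP: e'e.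
  by rewrite (enum4E (Q4 _ e'Q) e'E) (enum4E (Q4 _ eQ) eE).
rewrite negb_exists => /forallP H; rewrite big1 // => e eQ.
by have := H e; rewrite eQ /= => /negPf ->.
Qed.

(** An edge yields at most 6 tuples, with equality for one vertex in [A] and three in [B]. The error
    term counts the coincidences among [a, b, c]. *)
Lemma count4_le (T : finType) (M : {set {set T}}) (A B : {set T})
    (P : T -> T -> T -> T -> bool) :
  [disjoint A & B] -> (forall e, e \in M -> #|e| = 4%N) ->
  (forall i a b c, i \in A -> a \in B -> b \in B -> c \in B ->
     a != b -> a != c -> b != c -> P i a b c -> [set i; a; b; c] \in M) ->
  (\sum_(i in A) \sum_(a in B) \sum_(b in B) \sum_(c in B) P i a b c <=
     6 * #|M| + 3 * (#|A| * #|B| ^ 2))%N.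
Proof.
move=> AB M4 PM.
pose K e i a b c : bool := (i \in e :&: A) &&
  [&& a \in e :&: B, b \in (e :&: B) :\ a & c \in (e :&: B) :\ a :\ b].
have KS e : e \in M -> (\sum_i \sum_a \sum_b \sum_c K e i a b c <= 6)%N.
  move=> eM; apply: (@leq_trans (\sum_(i in e :&: A)
      #|e :&: B| * (#|e :&: B|.-1 * #|e :&: B|.-2)%N)).
    rewrite [leqRHS]big_mkcond; apply: leq_sum => i _; rewrite /K; case: ifP => _ /=.
      by rewrite sum_distinct3.
    by rewrite big1 // => a _; rewrite big1 // => b _; rewrite big1.
  rewrite sum_nat_const.
  have : (#|e :&: A| + #|e :&: B| <= 4)%N.
    rewrite -(M4 e eM) -cardsUI -setIUr [X in (_ + X <= _)%N](_ : _ = 0)%N ?addn0.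
      by rewrite subset_leq_card // subsetIl.
    by rewrite setIACA (disjoint_setI0 AB) setI0 cards0.
  by case: #|e :&: A| => [|[|[|[|[|?]]]]]; case: #|e :&: B| => [|[|[|[|[|?]]]]].
pose D (a b c : T) : nat := ((a == b) + (a == c) + (b == c))%N.
have -> : (3 * (#|A| * #|B| ^ 2) =
    \sum_(i in A) \sum_(a in B) \sum_(b in B) \sum_(c in B) D a b c)%N.
  have eq1 a : a \in B -> (\sum_(c in B) (a == c) = 1)%N.
    move=> aB; rewrite (bigD1 a) //= eqxx big1 // => c /andP[_ ca].
    by rewrite eq_sym (negPf ca).
  have row a b : a \in B -> b \in B -> (\sum_(c in B) D a b c = #|B| * (a == b) + 2)%N.
    by move=> aB bB; rewrite /D !big_split /= !eq1 // sum_nat_const -addnA.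
  have plane a : a \in B -> (\sum_(b in B) \sum_(c in B) D a b c = 3 * #|B|)%N.
    move=> aB; under eq_bigr => b bB do rewrite row //.
    by rewrite big_split /= -big_distrr /= eq1 // sum_nat_const; lia.
  under eq_bigr => i _.
    under eq_bigr => a aB do rewrite plane //.
    over.
  by rewrite !sum_nat_const expnS expn1; lia.
apply: (@leq_trans (\sum_(i in A) \sum_(a in B) \sum_(b in B) \sum_(c in B)
    (\sum_(e in M) K e i a b c + D a b c))).
  apply: leq_sum => i iA; apply: leq_sum => a aB; apply: leq_sum => b bB.
  apply: leq_sum => c cB; case: (boolP (P i a b c)) => // PT; rewrite /D.
  case: eqVneq => [_|ab]; first by apply: leq_trans (leq_addl _ _).
  case: eqVneq => [_|ac]; first by apply: leq_trans (leq_addl _ _).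
  case: eqVneq => [_|bc]; first by apply: leq_trans (leq_addl _ _).
  have eM := PM _ _ _ _ iA aB bB cB ab ac bc PT.
  have nAB v : v \in A -> v \notin B by move=> vA; rewrite (disjointFr AB vA).
  rewrite (bigD1 [set i; a; b; c]) //= /K !inE !eqxx !orbT iA aB bB cB /=.
  by rewrite eq_sym ab [c == b]eq_sym bc [c == a]eq_sym ac.
rewrite [leqLHS](_ : _ =
  (\sum_(i in A) \sum_(a in B) \sum_(b in B) \sum_(c in B) \sum_(e in M) K e i a b c) +
  (\sum_(i in A) \sum_(a in B) \sum_(b in B) \sum_(c in B) D a b c))%N; last first.
  rewrite -big_split; apply: eq_bigr => i _; rewrite -big_split; apply: eq_bigr => a _.
  by rewrite -big_split; apply: eq_bigr => b _; rewrite -big_split.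
rewrite leq_add2r mulnC -sum_nat_const.
apply: (@leq_trans (\sum_(e in M) \sum_i \sum_a \sum_b \sum_c K e i a b c)); last first.
  by apply: leq_sum => e /KS.
have sub (X : {set T}) (f : T -> nat) : (\sum_(v in X) f v <= \sum_v f v)%N.
  by rewrite big_mkcond; apply: leq_sum => v _; case: ifP.
rewrite [leqRHS]exchange_big; apply: leq_trans (sub A _); apply: leq_sum => i _.
rewrite [leqRHS]exchange_big; apply: leq_trans (sub B _); apply: leq_sum => a _.
rewrite [leqRHS]exchange_big; apply: leq_trans (sub B _); apply: leq_sum => b _.
rewrite [leqRHS]exchange_big; exact: sub.
Qed.

Lemma sum4_mkcond (T : finType) (B : {set T}) (P : T -> T -> T -> T -> bool) :
  (\sum_(a in B) \sum_(b in B) \sum_(c in B) \sum_(d in B) P a b c d =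
   \sum_a \sum_b \sum_c \sum_d [&& a \in B, b \in B, c \in B, d \in B & P a b c d])%N.
Proof.
rewrite big_mkcond; apply: eq_bigr => a _; case: ifP => aB; last first.
  by rewrite big1 // => b _; rewrite big1 // => c _; rewrite big1.
rewrite big_mkcond; apply: eq_bigr => b _; case: ifP => bB; last first.
  by rewrite big1 // => c _; rewrite big1.
rewrite big_mkcond; apply: eq_bigr => c _; case: ifP => cB; last by rewrite big1.
by rewrite big_mkcond; apply: eq_bigr => d _; case: ifP.
Qed.

Lemma avg_card (R : realFieldType) (T : finType) (B : {set T}) (g : T -> R) :
  (0 < #|B|)%N -> #|B|%:R * avg B g = \sum_(a in B) g a.
Proof. by move=> B0; rewrite mulrC divfK // pnatr_eq0 -lt0n. Qed.

Lemma avg3_card (R : realFieldType) (T : finType) (B : {set T}) (P : T -> T -> T -> bool) :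
  (0 < #|B|)%N -> #|B|%:R ^+ 3 * avg3 B (fun a b c => (P a b c)%:R) =
    (\sum_(a in B) \sum_(b in B) \sum_(c in B) P a b c)%N%:R :> R.
Proof.
move=> B0; rewrite exprSr -mulrA avg_card // natr_sum mulr_sumr.
apply: eq_bigr => a _; rewrite exprSr -mulrA avg_card // natr_sum mulr_sumr.
by apply: eq_bigr => b _; rewrite avg_card // natr_sum.
Qed.

(** * Comparison of [G] with [H1] *)

Lemma card_first (n s : nat) : (s <= n)%N -> #|[set i : 'I_n | (i < s)%N]| = s.
Proof.
move=> sn; have inj : injective (widen_ord sn) by move=> i j /(congr1 val) /= /val_inj.
rewrite -[RHS]card_ord -(card_imset predT inj).
apply: eq_card => i; rewrite inE; apply/idP/imsetP; last by case=> j _ -> /=.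
by move=> si; exists (Ordinal si) => //; apply: val_inj.
Qed.

Lemma card_H1 (n s : nat) : (s <= n)%N -> (#|H1 n s| + 'C(n - s, 4) = 'C(n, 4))%N.
Proof.
move=> sn; set A := [set i : 'I_n | (i < s)%N].
have <- : #|[set e : {set 'I_n} | e \subset ~: A & #|e| == 4%N]| = 'C(n - s, 4).
  by rewrite cards_draws cardsCs setCK card_ord card_first.
have <- : #|[set e : {set 'I_n} | #|e| == 4%N]| = 'C(n, 4).
  by rewrite card_draws card_ord.
rewrite -(cardsID [set e : {set 'I_n} | e :&: A != set0] [set e : {set 'I_n} | #|e| == 4%N]).
congr (_ + _)%N; apply: eq_card => e; rewrite !inE //.
by rewrite negbK setI_eq0 disjoints_subset andbC.
Qed.

Lemma H1_exchange (R : realType) (n s : nat) (G : {set {set 'I_n}}) (w : 'I_n -> R) :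
  is_kgraph 4 G -> (0 < s)%N -> (s < n)%N -> 399 / 100 * s%:R <= (n - s)%:R :> R ->
  (forall v, 0 <= w v <= 1) -> (forall i j : 'I_n, (i <= j)%N -> w j <= w i) ->
  \sum_v w v <= s%:R -> (forall e, e \in G -> 1 <= \sum_(v in e) w v) ->
  101 / 100 * #|G :\: H1 n s|%:R <= #|H1 n s :\: G|%:R + n%:R ^+ 3 :> R.
Proof.
move=> Gk s0 sn sN w01 mono ws cov.
set A := [set i : 'I_n | (i < s)%N]; set B := ~: A.
have cA : #|A| = s by rewrite card_first // ltnW.
have cB : #|B| = (n - s)%N by rewrite cardsCs setCK card_ord cA.
have AB : [disjoint A & B] by rewrite disjoints_subset setCK.
have B0 : (0 < #|B|)%N by rewrite cB subn_gt0.
have A0 : (0 < #|A|)%N by rewrite cA.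
(* Numbering starts at 0, so vertex [s] is the first of [B]; by monotonicity [M] is the largest
   weight on [B]. *)
set M := w (Ordinal sn).
have M01 := w01 (Ordinal sn); rewrite -/M in M01; case/andP: M01 => M0 M1.
have wB v : v \in B -> w v <= M by rewrite !inE -leqNgt => sv; apply: mono.
have wA v : v \in A -> M <= w v by rewrite inE => /ltnW vs; apply: mono.
have Q4 e : e \in G :\: H1 n s -> #|e| = 4%N by case/setDP => /Gk.
have QB e v : e \in G :\: H1 n s -> v \in e -> v \in B.
  case/setDP => eG; rewrite inE (Gk e eG) eqxx /= negbK => /eqP eA ve.
  by rewrite inE; apply/negP => vA; have := in_set0 v; rewrite -eA inE ve vA.
(* If [M = 0], an edge outside [H1] would lie in [B] and have weight 0, so there is none. *)
have [M00|Mn0] := eqVneq M 0.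
  rewrite (_ : G :\: H1 n s = set0) ?cards0 ?mulr0 ?addr_ge0 ?exprn_ge0 //.
  apply/eqP/set0Pn => -[e eQ]; have /cov : e \in G by case/setDP: eQ.
  rewrite leNgt => /negP; apply; rewrite (le_lt_trans _ ltr01) // sumr_le0 // => v ve.
  by rewrite -M00 wB // (QB e).
have M_gt0 : 0 < M by rewrite lt0r Mn0.
(* The default 0 keeps the bounds on [x] and [D] valid at all vertices. *)
pose x v : R := if v \in B then w v / M else 0.
pose D v : R := if v \in A then (1 - w v) / M else 0.
pose d : R := (1 - M) / M.
have d1 : d + 1 = M^-1 by rewrite /d mulrBl mul1r divff // subrK.
have d0 : 0 <= d by rewrite divr_ge0 ?subr_ge0.
have x01 v : 0 <= x v <= 1.
  rewrite /x; case: ifP => vB; last by rewrite lexx ler01.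
  by case/andP: (w01 v) => wv0 _; rewrite divr_ge0 //= ler_pdivrMr // mul1r wB.
have Dd v : D v <= d.
  by rewrite /D; case: ifP => // vA; rewrite ler_wpM2r ?invr_ge0 // lerB // wA.
have xD : \sum_(b in B) x b <= \sum_(i in A) D i.
  rewrite (eq_bigr (fun v => w v / M)) => [|v vB]; last by rewrite /x vB.
  rewrite [leRHS](eq_bigr (fun v => (1 - w v) / M)) => [|v vA]; last by rewrite /D vA.
  rewrite -!mulr_suml ler_wpM2r ?invr_ge0 // sumrB sumr_const cA lerBrDl.
  rewrite -[s%:R]/(s%:R) in ws *; apply: le_trans ws.
  rewrite [leRHS](bigID (mem A)) /= lerD2l le_eqVlt; apply/orP; left; apply/eqP.
  by apply: eq_bigl => v; rewrite inE.
have cAB : 399 / 100 * #|A|%:R <= #|B|%:R :> R by rewrite cA cB.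
have key := lower3_tail4 A0 B0 cAB x01 Dd d0 xD.
have tailE : #|B|%:R ^+ 4 * tail4 B x (d + 1) = (\sum_(a in B) \sum_(b in B)
    \sum_(c in B) \sum_(e in B) (1 <= w a + w b + w c + w e)%R)%N%:R.
  rewrite exprSr -mulrA avg_card // natr_sum mulr_sumr; apply: eq_bigr => a aB.
  rewrite avg3_card //; congr (_%:R).
  apply: eq_bigr => b bB; apply: eq_bigr => c cB'; apply: eq_bigr => e eB.
  rewrite /x aB bB cB' eB d1 -!mulrDl ler_pdivlMr // mulVf //.
have tail_ge : 24 * #|G :\: H1 n s|%:R <= #|B|%:R ^+ 4 * tail4 B x (d + 1).
  rewrite tailE -natrM ler_nat sum4_mkcond; apply: count4_ge => // e a b c v eQ eE.
  have e4 := Q4 e eQ; have /cov : e \in G by case/setDP: eQ.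
  rewrite (sum_enum4E w e4 eE) => ->; case/and4P: eE => ae be ce de.
  rewrite !(QB e) //.
  - by move: de; rewrite !inE; case/and4P.
  - by move: ce; rewrite !inE; case/and3P.
  - by move: be; rewrite !inE; case/andP.
have lower_le : #|A|%:R * #|B|%:R ^+ 3 * lower3 A B x D <=
    6 * #|H1 n s :\: G|%:R + 3 * (#|A|%:R * #|B|%:R ^+ 2).
  have lowerE : #|A|%:R * #|B|%:R ^+ 3 * lower3 A B x D =
      (\sum_(i in A) \sum_(a in B) \sum_(b in B) \sum_(c in B)
        (w a + w b + w c < 1 - w i)%R)%N%:R.
    rewrite mulrAC /lower3 avg_card // natr_sum mulr_suml; apply: eq_bigr => i iA.
    rewrite mulrC avg3_card //; congr (_%:R).
    apply: eq_bigr => a aB; apply: eq_bigr => b bB; apply: eq_bigr => c cB'.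
    by rewrite /x /D aB bB cB' iA -!mulrDl ltr_pdivlMr // divfK.
  rewrite lowerE -natrX -!natrM -natrD ler_nat; apply: count4_le => //.
    by move=> e /setDP[]; rewrite inE => /andP[/eqP].
  move=> i a b c iA aB bB cB' ab ac bc wlt.
  have ni v : v \in B -> i != v by move=> vB; apply: contraTneq vB => <-; rewrite inE iA.
  have [e4 eE] := enum4_set (ni a aB) (ni b bB) (ni c cB') ab ac bc.
  rewrite inE; apply/andP; split.
    apply/negP => /cov; rewrite (sum_enum4E w e4 eE) leNgt => /negP; apply.
    by move: wlt; clear; lra.
  rewrite inE e4 eqxx /=; apply/set0Pn; exists i; rewrite inE iA andbT.
  by case/andP: eE.
have nB0 : 0 < #|B|%:R :> R by rewrite ltr0n.
have nA0 : 0 <= #|A|%:R :> R by [].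
have nAn : #|A|%:R <= n%:R :> R by rewrite ler_nat cA ltnW.
have nBn : #|B|%:R <= n%:R :> R by rewrite ler_nat cB leq_subr.
have ABn : #|A|%:R * #|B|%:R ^+ 2 <= n%:R ^+ 3 :> R.
  rewrite [leRHS]exprS; apply: ler_pM => //; first by rewrite exprn_ge0 // ltW.
  by apply: lerXn2r; rewrite ?nnegrE // ltW.
(* After scaling by [#|B| ^ 3], edges count 24 times on the left and [4 * 6] times on the right,
   with error at most [12 * n ^ 3]. *)
have := ler_wpM2l (exprn_ge0 3 (ltW nB0)) key.
have n30 : 0 <= n%:R ^+ 3 :> R by rewrite exprn_ge0.
move: tail_ge lower_le ABn n30; clear.
move: (tail4 _ _ _) (lower3 _ _ _ _) (#|B|%:R) (#|A|%:R) => P F b a.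
move: (#|_|%:R) (#|_|%:R) (n%:R ^+ 3) => q m n3.
lra.
Qed.

(** Loss minus gain equals [#|H1 n s| - #|G|], at most [t]; since [101 / 100] of the gain is at most
    the loss plus [n ^ 3], a hundredth of the loss is at most [101 / 100 * t + n ^ 3]. *)
Lemma H1_stability (R : realType) (n s : nat) (G : {set {set 'I_n}}) (t : R) :
  (0 < s)%N -> (s < n)%N -> 399 / 100 * s%:R <= (n - s)%:R :> R ->
  is_kgraph 4 G -> is_stable 4 G -> fractional_matching_number R G <= s%:R ->
  'C(n, 4)%:R - 'C(n - s, 4)%:R - t <= #|G|%:R ->
  #|H1 n s :\: G|%:R <= 101 * t + 100 * n%:R ^+ 3.
Proof.
move=> s0 sn sN Gk Gs nu_s Gt.
have [w [w01 mono ws cov]] := monotone_cover Gk Gs nu_s.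
have exch := H1_exchange Gk s0 sn sN w01 mono ws cov.
have hE : #|H1 n s|%:R + 'C(n - s, 4)%:R = 'C(n, 4)%:R :> R.
  by rewrite -natrD card_H1 // ltnW.
have gE : #|G :&: H1 n s|%:R + #|G :\: H1 n s|%:R = #|G|%:R :> R.
  by rewrite -natrD cardsID.
have mE : #|G :&: H1 n s|%:R + #|H1 n s :\: G|%:R = #|H1 n s|%:R :> R.
  by rewrite setIC -natrD cardsID.
move: exch hE gE mE Gt; clear; lra.
Qed.

Theorem theorem2p1 (R : realType) (c : R) (c_gt0 : 0 < c) (c_lt : c < 1 / 5) :
  let delta : R := 10 ^- 10 in
  exists eps0 : R, 0 < eps0 /\
  forall eps : R, 0 < eps -> eps < eps0 ->
  exists n0 : nat, forall n s : nat,
    (n0 <= n)%N ->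
    c * n%:R <= s%:R ->
    s%:R <= (n%:R - 3) / (5 - delta) ->
  forall G : {set {set 'I_n}},
    is_kgraph 4 G ->
    is_stable 4 G ->
    fractional_matching_number R G <= s%:R ->
    'C(n, 4)%:R - 'C(n - s, 4)%:R - eps * n%:R ^+ 4 <= #|G|%:R ->
    eps_close 4 (100 * eps `^ (1 / 4)) G (H1 n s).
Proof.
move=> delta.
have delta_ge0 : 0 <= delta by rewrite invr_ge0 exprn_ge0.
have delta_le : delta <= 1 / 100.
  have -> : 1 / 100 = 10^-1 ^+ 2 :> R by field.
  rewrite /delta -exprVn; apply: ler_wiXn2l => //; clear; lra.
clearbody delta.
(* This makes the fourth root [y] of [eps] less than [1 / 2], hence [102 * y ^ 3 < 100] at the
   end. *)
exists (1 / 16); split; first by clear; lra.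
move=> eps eps_gt0 eps_lt.
set y := eps `^ (1 / 4).
have y_ge0 : 0 <= y by exact: powR_ge0.
have y4 : y ^+ 4 = eps.
  rewrite -powR_mulrn // -powRrM (_ : 1 / 4 * 4%:R = 1); last by field.
  by rewrite powRr1 // ltW.
have y_lt : y < 1 / 2.
  rewrite ltNge; apply/negP => hy; move: eps_lt; rewrite -y4 ltNge => /negP; apply.
  have -> : 1 / 16 = (1 / 2) ^+ 4 :> R by field.
  by apply: lerXn2r; rewrite ?nnegrE //; clear; lra.
(* For such [n] the error [100 * n ^ 3] is at most [eps * n ^ 4]. *)
exists (maxn 1 (Num.bound (100 / eps))) => n s; rewrite geq_max => /andP[n_gt0 n_large].
have n_pos : 0 < n%:R :> R by rewrite ltr0n.
have n_eps : 100 <= eps * n%:R.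
  rewrite mulrC -ler_pdivrMr //; apply: ltW.
  apply: lt_le_trans (archi_boundP _) _; first by rewrite divr_ge0 // ltW.
  by rewrite ler_nat.
move=> cs sn G Gk Gs nu_s eG.
have s_pos : 0 < s%:R :> R by apply: lt_le_trans cs; rewrite mulr_gt0.
have s_gt0 : (0 < s)%N by rewrite -(ltr0n R).
move: sn; rewrite ler_pdivlMr; last by move: delta_le; clear; lra.
move=> sn.
have ds : delta * s%:R <= 1 / 100 * s%:R by apply: ler_wpM2r => //; exact: ltW.
have s_lt : (s < n)%N.
  by rewrite -(ltr_nat R); move: sn ds s_pos; clear; lra.
(* The bound on [s] gives [(4 - delta) * s <= n - s], and [delta <= 1 / 100]. *)
have sB : 399 / 100 * s%:R <= (n - s)%:R :> R.
  by rewrite natrB 1?ltnW //; move: sn ds; clear; lra.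
have close := H1_stability s_gt0 s_lt sB Gk Gs nu_s eG.
apply: le_lt_trans close _.
have n4 : 0 < n%:R ^+ 4 :> R by rewrite exprn_gt0.
have n34 : 100 * n%:R ^+ 3 <= eps * n%:R ^+ 4 :> R.
  by rewrite [in leRHS]exprS mulrA; apply: ler_wpM2r => //; rewrite exprn_ge0 ?ltW.
apply: (@le_lt_trans _ _ (102 * eps * n%:R ^+ 4)).
  by move: n34; clear; lra.
rewrite ltr_pM2r // -y4 exprS.
have y_gt0 : 0 < y by rewrite powR_gt0.
have y3 : y ^+ 3 <= (1 / 2) ^+ 3.
  by apply: lerXn2r; rewrite ?nnegrE ?(ltW y_lt) //; clear; lra.
by rewrite mulrCA mulrC ltr_pM2r //; move: y3; clear; lra.
Qed.
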